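(* Let $K\ge K'$ be positive integers and $t\in[K']$, and put $$F'=\binom{K'}{t},\quad F=\binom{K}{t},\quad Z'=\binom{K'-1}{t-1},\quad Z=\binom{K-1}{t-1},\quad S=\binom{K'}{t+1},$$ and assume $Z<F'$. Let $f$ be a one-to-one map from the set of $(t+1)$-subsets of $[K']$ onto $\left[\binom{K'}{t+1}\right]$. Let $B=(b_{\tau,k})$ be the array with rows indexed by the $t$-subsets $\tau$ of $[K']$ and columns by $k\in[K']$, with $b_{\tau,k}=*$ if $k\in\tau$ and $b_{\tau,k}=f(\tau\cup\{k\})$ if $k\notin\tau$. Let $P=(p_{\tau,k})$ be the array with rows indexed by the $t$-subsets $\tau$ of $[K]$ and columns by $k\in[K]$, with $p_{\tau,k}=*$ if $k\in\tau$ and $p_{\tau,k}=\text{null}$ if $k\notin\tau$. Then $(P,B)$ is a $(K,K',F,F',Z,Z',S)$-HpPDA.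
   Context: Notation: $[n]=\{1,\dots,n\}$. PDA. For positive integers $K,F,Z,S$, a $[K,F,Z,S]$-PDA is an $F\times K$ array $(p_{j,k})$ with entries in $\{*\}\cup[S]$ such that: (C1) $*$ appears $Z$ times in each column; (C2) each integer of $[S]$ occurs at least once; (C3) if two distinct entries satisfy $p_{j_1,k_1}=p_{j_2,k_2}=s\in[S]$, then $j_1\ne j_2$, $k_1\neq k_2$ and $p_{j_1,k_2}=p_{j_2,k_1}=*$. HpPDA. Let $K,K',F,F',Z,Z',S$ be integers with $K\ge K'$, $F\ge F'$, $Z<F'$. A $(K,K',F,F',Z,Z',S)$-HpPDA is a pair $(P,B)$ where $P$ is an $F\times K$ array with entries ''$*$'' or ''null'', each column having exactly $Z$ stars; $B$ is a $[K',F',Z',S]$-PDA; and for each set $\tau$ of $K'$ columns of $P$ there is a set $\zeta$ of $F'$ rows of $P$ such that the subarray $[P]_{\zeta\times\tau}$ (rows $\zeta$, columns $\tau$, listed in a suitable order) has its stars in exactly the same positions as $B$. *)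

(* Defs.v *)
From mathcomp Require Import all_boot.

Set Implicit Arguments.
Unset Strict Implicit.
Unset Printing Implicit Defensive.

(* An F x K array over A with stars is a function [p : R -> C -> option A],
   where the row and column index types R and C satisfy #|R| = F and #|C| = K;
   [None] is the star.  The alphabet [S] = {1, ..., S} is represented by 'I_S,
   and the two-letter alphabet {*, null} by [option unit]. *)
Notation star := None (only parsing).
Notation null := (Some tt) (only parsing).

Definition is_star (A : Type) (x : option A) : bool := ~~ isSome x.

Definition nb_stars (A : Type) (R C : finType) (p : R -> C -> option A)
    (k : C) : nat :=
  #|[set j : R | is_star (p j k)]|.

Record is_PDA (K F Z S : nat) (R C : finType) (p : R -> C -> option 'I_S) :
    Prop := IsPDA {
  PDA_pos : [/\ 0 < K, 0 < F, 0 < Z & 0 < S];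
  PDA_rows : #|R| = F;
  PDA_cols : #|C| = K;
  PDA_C1 : forall k : C, nb_stars p k = Z;
  PDA_C2 : forall s : 'I_S, exists (j : R) (k : C), p j k = Some s;
  PDA_C3 : forall (s : 'I_S) (j1 j2 : R) (k1 k2 : C),
    (j1, k1) <> (j2, k2) -> p j1 k1 = Some s -> p j2 k2 = Some s ->
    [/\ j1 <> j2, k1 <> k2, p j1 k2 = star & p j2 k1 = star]
}.

Arguments is_PDA K F Z S {R C} p.

(* The maps r and c list the rows in zeta and the columns in tau in an order
   that makes the subarray comparable with B. *)
Definition same_stars_on (A A' : Type) (R C R' C' : finType)
    (P : R -> C -> option A) (B : R' -> C' -> option A')
    (zeta : {set R}) (tau : {set C}) : Prop :=
  exists (r : R' -> R) (c : C' -> C),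
    [/\ injective r, r @: [set: R'] = zeta,
        injective c, c @: [set: C'] = tau &
        forall (j : R') (k : C'), is_star (P (r j) (c k)) = is_star (B j k)].

Record is_HpPDA (K K' F F' Z Z' S : nat) (R C R' C' : finType)
    (P : R -> C -> option unit) (B : R' -> C' -> option 'I_S) :
    Prop := IsHpPDA {
  HpPDA_params : [/\ K' <= K, F' <= F & Z < F'];
  HpPDA_rows : #|R| = F;
  HpPDA_cols : #|C| = K;
  HpPDA_stars : forall k : C, nb_stars P k = Z;
  HpPDA_B : is_PDA K' F' Z' S B;
  HpPDA_sub : forall tau : {set C}, #|tau| = K' ->
    exists zeta : {set R}, #|zeta| = F' /\ same_stars_on P B zeta tau
}.

Arguments is_HpPDA K K' F F' Z Z' S {R C R' C'} P B.

Definition ksubset (n t : nat) : finType := {A : {set 'I_n} | #|A| == t}.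

Lemma card_ksubsetU1 (n t : nat) (A : ksubset n t) (k : 'I_n) :
  k \notin val A -> #|val A :|: [set k]| == t.+1.
Proof. by move=> kA; rewrite setUC cardsU1 kA (eqP (valP A)). Qed.

Definition ksubsetU1 (n t : nat) (A : ksubset n t) (k : 'I_n)
    (kA : k \notin val A) : ksubset n t.+1 :=
  exist _ (val A :|: [set k]) (card_ksubsetU1 kA).

Definition subset_B (K' t : nat) (f : ksubset K' t.+1 -> 'I_('C(K', t.+1)))
    (tau : ksubset K' t) (k : 'I_K') : option 'I_('C(K', t.+1)) :=
  match boolP (k \in val tau) with
  | AltTrue _ => star
  | AltFalse ktau => Some (f (ksubsetU1 ktau))
  end.

Definition subset_P (K t : nat) (tau : ksubset K t) (k : 'I_K) : option unit :=
  if k \in val tau then star else null.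

(* Main.v *)
Require Import Defs.
From mathcomp Require Import all_boot.

(** In both arrays a star at row [A], column [k] means [k \in A], so the star counts are counts of
    [t]-subsets through a point. For C3, injectivity of [f] turns equal integers in [B] into
    [k1 |: A1 = k2 |: A2]. Equal columns would force equal rows; distinct columns give [k1 \in A2]
    and [k2 \in A1], which are the required stars ([subset_B_PDA]). For the subarrays, an injection
    [c] from [K'] onto [tau] sends [A] to [c @: A] and preserves membership, hence stars
    ([same_stars_subset]). *)

Lemma card_ksubset (n t : nat) : #|ksubset n t| = 'C(n, t).
Proof.
rewrite card_sig -[in RHS](card_ord n) -(card_draws 'I_n t) cardsE.
exact: eq_card.
Qed.

(* Pascal's rule: the t-subsets avoiding k are the t-subsets of [set~ k]. *)
Lemma card_ksubset_mem (n t : nat) (k : 'I_n) :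
  0 < t -> #|[set A : ksubset n t | k \in val A]| = 'C(n.-1, t.-1).
Proof.
case: t => // t _; case: n k => [[]//|n] k /=.
rewrite -(card_imset _ val_inj) /=.
have -> : val @: [set A : ksubset n.+1 t.+1 | k \in val A]
        = [set A : {set 'I_n.+1} | #|A| == t.+1] :\:
          [set A : {set 'I_n.+1} | A \subset [set~ k] & #|A| == t.+1].
  apply/setP=> A; rewrite !inE subsetC sub1set inE.
  apply/imsetP/andP => [[[D cD] /[!inE] /= kD ->]|[+ cA]].
    by rewrite kD cD.
  rewrite cA andbT !negbK => kA.
  by exists (exist _ A cA); rewrite ?inE.
rewrite cardsD (setIidPr _); last first.
  by apply/subsetP=> A; rewrite !inE => /andP[].
rewrite card_draws cards_draws cardsC1 card_ord binS.
by rewrite addKn.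
Qed.

Lemma is_star_subset_P (K t : nat) (A : ksubset K t) (k : 'I_K) :
  is_star (subset_P A k) = (k \in val A).
Proof. by rewrite /subset_P; case: ifP. Qed.

Section SubsetB.
Variables (K' t : nat) (f : ksubset K' t.+1 -> 'I_('C(K', t.+1))).

Lemma is_star_subset_B (A : ksubset K' t) (k : 'I_K') :
  is_star (subset_B f A k) = (k \in val A).
Proof.
by rewrite /subset_B; refine (match boolP (k \in val A) with
  AltTrue _ => _ | AltFalse _ => _ end).
Qed.

Lemma subset_B_star (A : ksubset K' t) (k : 'I_K') :
  k \in val A -> subset_B f A k = None.
Proof. by rewrite -is_star_subset_B; case: subset_B. Qed.

Lemma subset_B_Some (A : ksubset K' t) (k : 'I_K') (kA : k \notin val A) :
  subset_B f A k = Some (f (ksubsetU1 kA)).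
Proof.
(* The entry contains the proof of non-membership produced by [boolP]; irrelevance of boolean proofs
   exchanges it for the given [kA]. *)
rewrite /subset_B; refine (match boolP (k \in val A) with
  AltTrue kA' => _ | AltFalse kA' => _ end).
  by case/negP: (kA).
by rewrite (bool_irrelevance kA' kA).
Qed.

(** Hides the proof-dependent [ksubsetU1] behind some [D], so that equal entries can be compared as
    plain sets. *)
Lemma subset_B_eq_Some (A : ksubset K' t) (k : 'I_K') (s : 'I_('C(K', t.+1))) :
  subset_B f A k = Some s ->
  k \notin val A /\ exists2 D, f D = s & val D = k |: val A.
Proof.
have [kA|kA] := boolP (k \in val A); first by rewrite subset_B_star.
rewrite (subset_B_Some _ _ kA) => -[<-]; split=> //.
by exists (ksubsetU1 kA); rewrite //= setUC.
Qed.

(** The strict bound [t < K'] gives a positive number of integers ['C(K', t.+1)]. *)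
Lemma subset_B_PDA : 0 < t < K' -> bijective f ->
  is_PDA K' 'C(K', t) 'C(K'.-1, t.-1) 'C(K', t.+1) (subset_B f).
Proof.
case/andP=> t0 tK' [g fK gK].
have K'0 : 0 < K' by apply: leq_ltn_trans tK'.
split; first split.
- exact: K'0.
- by rewrite bin_gt0 ltnW.
- by rewrite bin_gt0 -ltnS !prednK // ltnW.
- by rewrite bin_gt0.
- exact: card_ksubset.
- exact: card_ord.
- move=> k; rewrite -(card_ksubset_mem _ _ k t0) /nb_stars.
  by apply: eq_card => A; rewrite !inE is_star_subset_B.
(* The integer [s] labels the set [g s], nonempty since it has [t.+1] elements; it occurs in column
   [k] for any [k] in [g s], at row [g s] minus [k]. *)
- move=> s; have cD := eqP (valP (g s)).
  have /card_gt0P[k kD] : 0 < #|val (g s)| by rewrite cD.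
  have cA : #|val (g s) :\ k| == t by move: cD; rewrite (cardsD1 k) kD add1n => -[->].
  pose A : ksubset K' t := exist _ (val (g s) :\ k) cA.
  have kA : k \notin val A by rewrite !inE eqxx.
  exists A, k; rewrite (subset_B_Some _ _ kA) -[s in RHS]gK; congr (Some (f _)).
  by apply: val_inj; rewrite /= setUC setD1K.
- move=> s A1 A2 k1 k2 neq /subset_B_eq_Some[k1A1 [D1 fD1 vD1]].
  case/subset_B_eq_Some=> k2A2 [D2 fD2 vD2].
  have eqU : k1 |: val A1 = k2 |: val A2.
    by rewrite -vD1 -vD2 -(fK D1) -(fK D2) fD1 fD2.
  (* If the columns agreed, deleting the common point from [eqU] would make the rows agree,
     contradicting [neq]. *)
  have neqk : k1 != k2.
    apply: contra_notN neq => /eqP eqk; rewrite -eqk in eqU k2A2 *.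
    congr pair; apply: val_inj.
    by rewrite -(setU1K k1A1) eqU setU1K.
  have k2A1 : k2 \in val A1.
    by have := setU11 k2 (val A2); rewrite -eqU !inE eq_sym (negPf neqk).
  have k1A2 : k1 \in val A2.
    by have := setU11 k1 (val A1); rewrite eqU !inE (negPf neqk).
  split; try exact: subset_B_star.
    by move=> eqA; rewrite -eqA k2A1 in k2A2.
  exact/eqP.
Qed.

Lemma same_stars_subset (K : nat) (tau : {set 'I_K}) : #|tau| = K' ->
  exists zeta : {set ksubset K t}, #|zeta| = 'C(K', t) /\
    same_stars_on (@subset_P K t) (subset_B f) zeta tau.
Proof.
move=> ctau; pose c (k : 'I_K') : 'I_K := enum_val (cast_ord (esym ctau) k).
have c_inj : injective c by move=> x y /enum_val_inj/cast_ord_inj.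
have cr (A : ksubset K' t) : #|c @: val A| == t.
  by rewrite card_imset //; exact: valP A.
pose r (A : ksubset K' t) : ksubset K t := exist _ (c @: val A) (cr A).
have r_inj : injective r.
  by move=> A1 A2 /(congr1 val) /= /(imset_inj c_inj)/val_inj.
(* These rows are the [t]-subsets of [K] contained in [tau]. *)
exists (r @: [set: ksubset K' t]); split.
  by rewrite card_imset // cardsT card_ksubset.
exists r, c; split=> //.
  (* The image of [c] lies in [tau] and both have [K'] elements. *)
  apply/eqP; rewrite eqEcard card_imset // cardsT card_ord ctau leqnn andbT.
  by apply/subsetP=> _ /imsetP[k _ ->]; apply: enum_valP.
by move=> A k; rewrite is_star_subset_P is_star_subset_B /= mem_imset.
Qed.

End SubsetB.

Theorem theorem4 (K K' t : nat) (HK' : 0 < K') (HKK' : K' <= K)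
    (Ht : 1 <= t <= K')
    (HZ : 'C(K.-1, t.-1) < 'C(K', t))
    (f : ksubset K' t.+1 -> 'I_('C(K', t.+1))) (Hf : bijective f) :
  is_HpPDA K K' 'C(K, t) 'C(K', t) 'C(K.-1, t.-1) 'C(K'.-1, t.-1)
    'C(K', t.+1) (@subset_P K t) (subset_B f).
Proof.
have /andP[t0 tK'] := Ht.
(* If t = K' then F' = 1 <= Z; this is what makes S positive. *)
have ltK' : t < K'.
  rewrite ltn_neqAle tK' andbT; apply/eqP=> eqt.
  move: HZ; rewrite eqt binn ltnS leqNgt bin_gt0.
  by rewrite -ltnS !prednK ?HKK' // (leq_trans HK').
split.
- by split=> //; exact: leq_bin2l.
- exact: card_ksubset.
- exact: card_ord.
- move=> k; rewrite -(card_ksubset_mem _ _ k t0) /nb_stars.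
  by apply: eq_card => A; rewrite !inE is_star_subset_P.
- by apply: subset_B_PDA => //; rewrite t0.
- exact: same_stars_subset.
Qed.
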